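(* Let $(M,g)$ be a compact Riemannian manifold, $g=\langle\cdot,\cdot\rangle$, and let $J$ be an almost complex structure on $M$ which is a harmonic complex structure with respect to $g$, i.e. $\Delta J=0$. Let $e(J)=\frac12\sum_i\langle Je_i,Je_i\rangle$ be the energy density of $J$. Then $$\Delta e(J)=|\nabla J|^2-\sum_{i,j}\langle R(e_i,e_j)Je_i,Je_j\rangle+\sum_{i,j}\langle JR(e_i,e_j)e_i,Je_j\rangle,$$ where $\{e_i\}$ is any local orthonormal frame field and $|\nabla J|^2=\sum_{i,j}|(\nabla_{e_i}J)(e_j)|^2$.
   Context: Manifolds are smooth and without boundary. An almost complex structure $J$ on $M$ is a smooth section of $T^*M\otimes TM$ with $J^2=-1$ as an endomorphism $J:TM\to TM$; it is regarded as a $TM$-valued $1$-form. No compatibility between $J$ and $g$ is assumed. Let $\nabla$ be the Levi-Civita connection of $g$, extended to $TM$-valued $p$-forms $\omega\in\Gamma(\wedge^pT^*M\otimes TM)$ by $$(\nabla_X\omega)(X_1,\dots,X_p)=\nabla_X(\omega(X_1,\dots,X_p))-\sum_j\omega(X_1,\dots,\nabla_XX_j,\dots,X_p).$$ Define $$d\omega(X_0,\dots,X_p)=\sum_{k=0}^p(-1)^k(\nabla_{X_k}\omega)(X_0,\dots,\hat X_k,\dots,X_p),$$ $$\delta\omega(X_1,\dots,X_{p-1})=-\sum_i(\nabla_{e_i}\omega)(e_i,X_1,\dots,X_{p-1}),$$ where $\{e_i\}$ is a local orthonormal frame and $\hat X_k$ means that $X_k$ is omitted; $\delta=0$ on $0$-forms.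 The Hodge-Laplace operator on $TM$-valued forms is $\Delta=d\delta+\delta d$. For $M$ compact, $J$ is called a harmonic complex structure (with respect to $g$) if $\Delta J=0$. On real-valued functions, $\Delta$ denotes the trace of the Hessian: $\Delta f=\sum_i\big(e_ie_if-(\nabla_{e_i}e_i)f\big)$. The curvature convention is $R(X,Y)=-\nabla_X\nabla_Y+\nabla_Y\nabla_X+\nabla_{[X,Y]}$. *)

(* Defs.v *)
From HB Require Import structures.
From mathcomp Require Import all_boot all_order all_algebra.
From mathcomp Require Import all_classical all_reals all_analysis.

Set Implicit Arguments.
Unset Strict Implicit.
Unset Printing Implicit Defensive.
Import Order.TTheory GRing.Theory Num.Theory.
Import numFieldNormedType.Exports.

Local Open Scope classical_set_scope.
Local Open Scope ring_scope.

(* iter_derive f [:: v1; ..; vk] = 'D_vk (.. ('D_v1 f)) *)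
Fixpoint iter_derive (R : realType) (V W : normedModType R) (f : V -> W)
    (s : seq V) : V -> W :=
  if s is v :: s' then iter_derive ('D_v f) s' else f.

(* C^infinity on A (meant for A open): f and all its iterated directional
   derivatives are (Frechet) differentiable at each point of A. *)
Definition smooth_on (R : realType) (V W : normedModType R) (A : set V)
    (f : V -> W) : Prop :=
  forall (s : seq V) (x : V), A x -> differentiable (iter_derive f s) x.

(* A chart is a homeomorphism from an open set dom onto an open subset of R^n;
   chart_map and chart_inv carry no information outside dom and its image. *)
Record chart (R : realType) (n : nat) (M : topologicalType) := Chart {
  chart_map :> M -> 'rV[R]_n;
  dom : set M;
  chart_inv : 'rV[R]_n -> M;
  dom_open : open dom;
  image_open : open (chart_map @` dom);
  chart_invK : forall x, dom x -> chart_inv (chart_map x) = x;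
  chart_continuous : forall x, dom x -> {for x, continuous chart_map};
  chart_inv_continuous : forall y, (chart_map @` dom) y ->
    {for y, continuous chart_inv}
}.

(* As usual for smooth atlases, plus a preferred chart chart_at x of the atlas
   around every x; it only serves to represent tangent vectors (see below). *)
Record smooth_manifold (R : realType) (n : nat) := SmoothManifold {
  carrier :> topologicalType;
  manifold_hausdorff : hausdorff_space carrier;
  manifold_second_countable : @second_countable carrier;
  atlas : set (chart R n carrier);
  chart_at : carrier -> chart R n carrier;
  chart_at_atlas : forall x, atlas (chart_at x);
  dom_chart_at : forall x, dom (chart_at x) x;
  atlas_compatible : forall c c', atlas c -> atlas c' ->
    smooth_on (c @` (dom c `&` dom c')) (c' \o chart_inv c)
}.

Definition smooth_fun (R : realType) (n : nat) (M : smooth_manifold R n)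
    (U : set M) (f : M -> R) : Prop :=
  forall c, atlas c -> smooth_on (c @` (U `&` dom c)) (f \o chart_inv c).

(* A tangent vector at x is represented by its components in chart_at x, so
   that T_x M is 'rV[R]_n. This is the derivative v(f) of f along v. *)
Definition dir_derive (R : realType) (n : nat) (M : smooth_manifold R n)
    (x : M) (v : 'rV[R]_n) (f : M -> R) : R :=
  'D_v (f \o chart_inv (chart_at x)) (chart_at x x).

(* Components in the chart c of the tangent vector v at x. *)
Definition tangent_coord (R : realType) (n : nat) (M : smooth_manifold R n)
    (c : chart R n M) (x : M) (v : 'rV[R]_n) : 'rV[R]_n :=
  'D_v (c \o chart_inv (chart_at x)) (chart_at x x).

(* Arbitrary sections of TM; local vector fields on an open set U are sections
   that are smooth on U, their values outside U being irrelevant. *)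
Definition vfield (R : realType) (n : nat) (M : smooth_manifold R n) : Type :=
  M -> 'rV[R]_n.

Definition chart_rep (R : realType) (n : nat) (M : smooth_manifold R n)
    (c : chart R n M) (X : vfield M) (y : 'rV[R]_n) : 'rV[R]_n :=
  tangent_coord c (chart_inv c y) (X (chart_inv c y)).

Definition smooth_vfield (R : realType) (n : nat) (M : smooth_manifold R n)
    (U : set M) (X : vfield M) : Prop :=
  forall c, atlas c -> smooth_on (c @` (U `&` dom c)) (chart_rep c X).

(* [X, Y]^i = X^j d_j Y^i - Y^j d_j X^i in the chart chart_at x *)
Definition lie_bracket (R : realType) (n : nat) (M : smooth_manifold R n)
    (X Y : vfield M) : vfield M := fun x =>
  'D_(X x) (chart_rep (chart_at x) Y) (chart_at x x)
  - 'D_(Y x) (chart_rep (chart_at x) X) (chart_at x x).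

Record riemannian_metric (R : realType) (n : nat) (M : smooth_manifold R n) :=
  RiemannianMetric {
  metric :> M -> 'rV[R]_n -> 'rV[R]_n -> R;
  metric_linear : forall x w, linear_for *%R (fun v => metric x v w);
  metric_sym : forall x v w, metric x v w = metric x w v;
  metric_pos : forall x v, v != 0 -> 0 < metric x v v;
  metric_smooth : forall (U : set M) (X Y : vfield M), open U ->
    smooth_vfield U X -> smooth_vfield U Y ->
    smooth_fun U (fun x => metric x (X x) (Y x))
}.

(* D x v Y stands for the covariant derivative of Y at x along v in T_x M. *)
Definition connection (R : realType) (n : nat) (M : smooth_manifold R n)
    : Type :=
  forall x : M, 'rV[R]_n -> vfield M -> 'rV[R]_n.

Definition cov (R : realType) (n : nat) (M : smooth_manifold R n)
    (D : connection M) (X Y : vfield M) : vfield M :=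
  fun x => D x (X x) Y.

(* The torsion-free metric connection of g. Only its values on fields that are
   smooth around the point are constrained; locality in the field follows from
   the Leibniz rule, as f may be the indicator function of an open set. *)
Record levi_civita (R : realType) (n : nat) (M : smooth_manifold R n)
    (g : riemannian_metric M) (D : connection M) : Prop := LeviCivita {
  conn_linear : forall (U : set M) (x : M) (Y : vfield M), open U -> U x ->
    smooth_vfield U Y -> linear (fun v => D x v Y);
  conn_add : forall (U : set M) (x : M) (v : 'rV[R]_n) (Y Z : vfield M),
    open U -> U x -> smooth_vfield U Y -> smooth_vfield U Z ->
    D x v (fun y => Y y + Z y) = D x v Y + D x v Z;
  conn_leibniz : forall (U : set M) (x : M) (v : 'rV[R]_n) (f : M -> R)
    (Y : vfield M), open U -> U x -> smooth_fun U f -> smooth_vfield U Y ->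
    D x v (fun y => f y *: Y y) = dir_derive x v f *: Y x + f x *: D x v Y;
  conn_smooth : forall (U : set M) (X Y : vfield M), open U ->
    smooth_vfield U X -> smooth_vfield U Y -> smooth_vfield U (cov D X Y);
  conn_metric : forall (U : set M) (x : M) (v : 'rV[R]_n) (Y Z : vfield M),
    open U -> U x -> smooth_vfield U Y -> smooth_vfield U Z ->
    dir_derive x v (fun y => g y (Y y) (Z y))
      = g x (D x v Y) (Z x) + g x (Y x) (D x v Z);
  conn_torsion_free : forall (U : set M) (x : M) (X Y : vfield M),
    open U -> U x -> smooth_vfield U X -> smooth_vfield U Y ->
    cov D X Y x - cov D Y X x = lie_bracket X Y x
}.

(* R(X, Y) Z = - D_X D_Y Z + D_Y D_X Z + D_[X, Y] Z *)
Definition curvature (R : realType) (n : nat) (M : smooth_manifold R n)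
    (D : connection M) (X Y Z : vfield M) : vfield M := fun x =>
  - cov D X (cov D Y Z) x + cov D Y (cov D X Z) x
  + cov D (lie_bracket X Y) Z x.

Definition orthonormal_frame (R : realType) (n : nat) (M : smooth_manifold R n)
    (g : riemannian_metric M) (U : set M) (e : 'I_n -> vfield M) : Prop :=
  (forall i, smooth_vfield U (e i)) /\
  (forall x, U x -> forall i j, g x (e i x) (e j x) = (i == j)%:R).

(* A chosen orthonormal frame defined around x. The operators below that are
   traces over a local orthonormal frame are evaluated at x with this one;
   their values do not depend on the choice. *)
Definition frame_at (R : realType) (n : nat) (M : smooth_manifold R n)
    (g : riemannian_metric M) (x : M) : 'I_n -> vfield M :=
  xget (fun _ _ => 0)
    [set e : {classic 'I_n -> vfield M} |
      exists U : set M, [/\ open U, U x & orthonormal_frame g U e]].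

(* TM-valued p-forms, as operators on p-tuples of vector fields. *)
Definition vform (R : realType) (n : nat) (M : smooth_manifold R n) (p : nat)
    : Type :=
  ('I_p -> vfield M) -> vfield M.

Definition cov_form (R : realType) (n : nat) (M : smooth_manifold R n)
    (D : connection M) (p : nat) (X : vfield M) (w : vform M p) : vform M p :=
  fun Xs x =>
    cov D X (w Xs) x
    - \sum_(j < p) w (fun k => if k == j then cov D X (Xs j) else Xs k) x.

Definition ext_deriv (R : realType) (n : nat) (M : smooth_manifold R n)
    (D : connection M) (p : nat) (w : vform M p) : vform M p.+1 :=
  fun Xs x =>
    \sum_(k < p.+1)
      (-1) ^+ k *: cov_form D (Xs k) w (fun j => Xs (lift k j)) x.

(* The tuple (X, Xs_0, Xs_1, ...). *)
Definition cons_fields (R : realType) (n : nat) (M : smooth_manifold R n)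
    (p : nat) (X : vfield M) (Xs : 'I_p -> vfield M) : 'I_p.+1 -> vfield M :=
  fun k => if unlift ord0 k is Some j then Xs j else X.

Definition codiff (R : realType) (n : nat) (M : smooth_manifold R n)
    (g : riemannian_metric M) (D : connection M) (p : nat) (w : vform M p.+1)
    : vform M p :=
  fun Xs x => let e := frame_at g x in
    - \sum_(i < n) cov_form D (e i) w (cons_fields (e i) Xs) x.

(* d delta + delta d; the first term is absent in degree 0, where delta = 0 *)
Definition hodge_laplacian (R : realType) (n : nat) (M : smooth_manifold R n)
    (g : riemannian_metric M) (D : connection M) (p : nat)
    : vform M p -> vform M p :=
  match p with
  | 0 => fun w => codiff g D (ext_deriv D w)
  | p'.+1 => fun w Xs x =>
      ext_deriv D (codiff g D w) Xs x + codiff g D (ext_deriv D w) Xs x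
  end.

Definition endo_field (R : realType) (n : nat) (M : smooth_manifold R n)
    : Type :=
  M -> {linear 'rV[R]_n -> 'rV[R]_n}.

Definition endo_apply (R : realType) (n : nat) (M : smooth_manifold R n)
    (J : endo_field M) (X : vfield M) : vfield M :=
  fun x => J x (X x).

Definition endo_form (R : realType) (n : nat) (M : smooth_manifold R n)
    (J : endo_field M) : vform M 1 :=
  fun Xs => endo_apply J (Xs ord0).

Definition almost_complex (R : realType) (n : nat) (M : smooth_manifold R n)
    (J : endo_field M) : Prop :=
  (forall (U : set M) (X : vfield M), open U -> smooth_vfield U X ->
     smooth_vfield U (endo_apply J X)) /\
  (forall x v, J x (J x v) = - v).

(* Delta J = 0: Delta J is a form, so it suffices to evaluate it at x on
   fields that are smooth around x. *)
Definition harmonic_complex_structure (R : realType) (n : nat)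
    (M : smooth_manifold R n) (g : riemannian_metric M) (D : connection M)
    (J : endo_field M) : Prop :=
  almost_complex J /\
  (forall (U : set M) (x : M) (Xs : 'I_1 -> vfield M), open U -> U x ->
     (forall i, smooth_vfield U (Xs i)) ->
     hodge_laplacian g D (endo_form J) Xs x = 0).

Definition energy_density (R : realType) (n : nat) (M : smooth_manifold R n)
    (g : riemannian_metric M) (J : endo_field M) : M -> R :=
  fun x => let e := frame_at g x in
    2^-1 * \sum_(i < n) g x (endo_apply J (e i) x) (endo_apply J (e i) x).

(* Trace of the Hessian: sum_i (e_i e_i f - (D_{e_i} e_i) f). *)
Definition laplacian (R : realType) (n : nat) (M : smooth_manifold R n)
    (g : riemannian_metric M) (D : connection M) (f : M -> R) : M -> R :=
  fun x => let e := frame_at g x in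
    \sum_(i < n)
      (dir_derive x (e i x) (fun y => dir_derive y (e i y) f)
       - dir_derive x (cov D (e i) (e i) x) f).

(* Main.v *)
Require Import Defs.
From HB Require Import structures.
From mathcomp Require Import all_boot all_order all_algebra.
From mathcomp Require Import ring.
From mathcomp Require Import all_classical all_reals all_analysis.

Set Implicit Arguments.
Unset Strict Implicit.
Unset Printing Implicit Defensive.
Import Order.TTheory GRing.Theory Num.Theory.
Import numFieldNormedType.Exports.

Local Open Scope classical_set_scope.
Local Open Scope ring_scope.

(** The identity is a Bochner formula, obtained by differentiating the energy
    density twice and replacing the rough Laplacian of J by curvature terms.

    Write N(X, Z) for (D_X J)(Z) and H(X, Y, Z) for the second covariant
    derivative (D^2_{X,Y} J)(Z), that is, the covariant derivative of the tensor
    N. On a frame e the energy density is one half of the sum of |J e_j|^2. In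
    its derivative along Y, the terms in which D_Y falls on the frame are
    B(D_Y e_j, e_j) + B(e_j, D_Y e_j) for a bilinear B, and these sum to zero
    because the matrix <D_Y e_j, e_k> is skew ([trace_skew]). Hence
      Y e(J) = sum_j <N(Y, e_j), J e_j>,
    and the same cancellation at second order gives
      Hess e(J) (X, Y)
        = sum_j <H(X, Y, e_j), J e_j> + <N(Y, e_j), N(X, e_j)>
    ([hess_energy]). Its trace is |DJ|^2 + sum_ij <H(e_i, e_i, e_j), J e_j>.

    On the other side, d delta J (Z) = - sum_i H(Z, e_i, e_i)
    ([ext_deriv_codiff], again by skewness) and
    delta d J (Z) = - sum_i (H(e_i, e_i, Z) - H(e_i, Z, e_i)) ([codiff_ext]),
    so that harmonicity reads
      sum_i H(e_i, e_i, Z) = sum_i (H(e_i, Z, e_i) - H(Z, e_i, e_i)),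
    and the Ricci identity ([ricci_identity]) turns the right-hand side into
    sum_i (- R(e_i, Z) (J e_i) + J (R(e_i, Z) e_i)). Taking Z = e_j and pairing
    with J e_j yields the formula.

    The operators codiff, laplacian and energy_density take their traces in a
    frame chosen separately at each point, which need not vary smoothly, while
    the formula is stated in a given frame e. The two are exchanged by
    [trace_orthonormal], which applies to bilinear maps of tangent vectors; so N
    and H, which are built from operators on vector fields, have first to be
    shown tensorial ([nabla_endoE], [cov_tensor2E]). Tensoriality is read off
    from the Leibniz rule for fields written as combinations of other fields
    ([conn_expand]), the combination being the expansion in the frame e, whose
    coefficients are smooth. *)

(** * Smooth maps between normed spaces *)

Section SmoothOn.
Variables (R : realType) (V : normedModType R).

Lemma differentiable_near_eq (W : normedModType R) (f g : V -> W) (x : V) :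
  (\near x, f x = g x) -> differentiable f x -> differentiable g x.
Proof.
move=> fg df; have fgx : f x = g x by exact: nbhs_singleton fg.
have [cf /eqaddoP ef] := (iffLR (diff_locallyP _ _)) df.
have fg0 : \forall h \near (0 : V), f (h + x) = g (h + x).
  have sx : h + x @[h --> (0 : V)] --> x.
    rewrite -[X in _ --> X]add0r.
    by apply: cvgD; [exact: cvg_id|exact: cvg_cst].
  exact: sx fg.
have eg : g \o shift x = cst (g x) + 'd f x +o_ (0 : V) id.
  apply/eqaddoP => e e0; rewrite -fgx.
  by apply: filterS2 fg0 (ef e e0) => h; rewrite !fctE /= => ->.
by apply/diff_locallyP; rewrite (diff_unique cf eg).
Qed.

(** The Leibniz rule, as the chain rule through the continuous bilinear map
    (a, w) |-> a *: w. *)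
Lemma differentiable_scale (W : normedModType R) (f : V -> R) (g : V -> W) x :
  differentiable f x -> differentiable g x ->
  differentiable (fun z => f z *: g z) x /\
  forall v, 'D_v (fun z => f z *: g z) x = 'D_v f x *: g x + f x *: 'D_v g x.
Proof.
move=> df dg.
have sbil : bilinear_for (GRing.Scale.Law.clone _ _ *:%R _)
    (GRing.Scale.Law.clone _ _ *:%R _) (fun (a : R^o) (w : W) => a *: w).
  split=> [w|a] b y z /=.
  - by rewrite scalerDl scalerA.
  - by rewrite scalerDr !scalerA mulrC.
pose B := bilinear_isBilinear.Build R R^o W W _ _
  (fun (a : R^o) (w : W) => a *: w) sbil.
pose b : {bilinear R^o -> W -> W} :=
  HB.pack (fun (a : R^o) (w : W) => a *: w) B.
have bc : continuous (fun p : R^o * W => b p.1 p.2) by exact: scale_continuous.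
have dp := differentiable_pair df dg.
have dfg : differentiable (fun z => f z *: g z) x.
  exact: (differentiable_comp dp (differentiable_bilin (f x, g x) bc)).
split=> // v; rewrite deriveE //.
have -> : 'd (fun z => f z *: g z) x v
    = ('d (fun p : R^o * W => b p.1 p.2) (f x, g x)
       \o 'd (fun z => (f z : R^o, g z)) x) v.
  by rewrite -(diff_comp dp (differentiable_bilin (f x, g x) bc)).
have db q : 'd (fun p : R^o * W => b p.1 p.2) (f x, g x) q
    = f x *: q.2 + q.1 *: g x by rewrite (diff_bilin (f x, g x) bc).
by rewrite [LHS]db (diff_pair df dg) /= addrC !deriveE.
Qed.

(** The Leibniz rule replaces one product by a sum of two products, so closure
    of smoothness under scaling cannot be proved one list of directions at a
    time: the induction needs all lists of bounded length at once. *)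
Definition smooth_upto (W : normedModType R) (k : nat) (A : set V)
    (f : V -> W) : Prop :=
  forall (s : seq V) (x : V), (size s <= k)%N -> A x ->
    differentiable (iter_derive f s) x.

Lemma open_eq_near (T : topologicalType) (W : Type) (A : set T) (f g : T -> W)
    (x : T) : open A -> {in A, f =1 g} -> A x -> \near x, f x = g x.
Proof.
move=> oA fg Ax; have := open_nbhs_nbhs (conj oA Ax).
by apply: filterS => y Ay; apply: fg; rewrite inE.
Qed.

Lemma eq_iter_derive (W : normedModType R) (A : set V) (f g : V -> W) s :
  open A -> {in A, f =1 g} -> {in A, iter_derive f s =1 iter_derive g s}.
Proof.
move=> oA; elim: s f g => [//|v s IH] f g fg /=; apply: IH => x.
by rewrite inE => Ax; exact/near_eq_derive/(open_eq_near oA).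
Qed.

Lemma eq_smooth_upto (W : normedModType R) k (A : set V) (f g : V -> W) :
  open A -> {in A, f =1 g} -> smooth_upto k A f -> smooth_upto k A g.
Proof.
move=> oA fg fs s x sk Ax; apply: differentiable_near_eq (fs s x sk Ax).
exact: (open_eq_near oA (eq_iter_derive s oA fg) Ax).
Qed.

Lemma smooth_upto0 (W : normedModType R) (A : set V) (f : V -> W) :
  smooth_upto 0 A f <-> forall x, A x -> differentiable f x.
Proof.
split=> [fs x|fd [|//] x _]; [exact: (fs [::])|exact: fd].
Qed.

Lemma smooth_uptoS (W : normedModType R) k (A : set V) (f : V -> W) :
  smooth_upto k.+1 A f <->
  (forall x, A x -> differentiable f x) /\ forall v, smooth_upto k A ('D_v f).
Proof.
split=> [fs|[fd fs] [|v s] x sk Ax]; [|exact: fd|exact: fs].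
split=> [x Ax|v s x sk Ax]; [exact: (fs [::])|exact: (fs (v :: s))].
Qed.

Lemma smooth_onP (W : normedModType R) (A : set V) (f : V -> W) :
  smooth_on A f <-> forall k, smooth_upto k A f.
Proof.
by split=> fs => [k s x _|s x]; [|apply: (fs (size s))] => //; exact: fs.
Qed.

Lemma smooth_uptoW (W : normedModType R) k l (A : set V) (f : V -> W) :
  (k <= l)%N -> smooth_upto l A f -> smooth_upto k A f.
Proof. by move=> kl fs s x sk; apply: fs; exact: leq_trans sk kl. Qed.

Lemma smooth_uptoD (W : normedModType R) k (A : set V) (f g : V -> W) :
  open A -> smooth_upto k A f -> smooth_upto k A g ->
  smooth_upto k A (fun z => f z + g z).
Proof.
move=> oA; elim: k f g => [|k IH] f g.
  rewrite !smooth_upto0 => df dg x Ax.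
  exact: differentiableD (df x Ax) (dg x Ax).
rewrite !smooth_uptoS => -[df fs] [dg gs]; split=> [x Ax|v].
  exact: differentiableD (df x Ax) (dg x Ax).
apply: eq_smooth_upto (IH _ _ (fs v) (gs v)) => // x; rewrite inE => Ax.
by rewrite -deriveD //; apply: diff_derivable; [exact: df|exact: dg].
Qed.

Lemma smooth_uptoZ (W : normedModType R) k (A : set V) (f : V -> R)
    (g : V -> W) :
  open A -> smooth_upto k A f -> smooth_upto k A g ->
  smooth_upto k A (fun z => f z *: g z).
Proof.
move=> oA; elim: k f g => [|k IH] f g.
  rewrite !smooth_upto0 => df dg x Ax.
  exact: (differentiable_scale (df x Ax) (dg x Ax)).1.
move=> fS gS; have fk := smooth_uptoW (leqnSn k) fS.
have gk := smooth_uptoW (leqnSn k) gS; move: fS gS.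
rewrite !smooth_uptoS => -[df fs] [dg gs]; split=> [x Ax|v].
  exact: (differentiable_scale (df x Ax) (dg x Ax)).1.
have prod_rule := smooth_uptoD oA (IH _ _ (fs v) gk) (IH _ _ fk (gs v)).
apply: eq_smooth_upto oA _ prod_rule.
move=> x; rewrite inE => Ax.
by rewrite (differentiable_scale (df x Ax) (dg x Ax)).2.
Qed.

Lemma smooth_on_cst (W : normedModType R) (A : set V) (a : W) :
  smooth_on A (fun=> a).
Proof.
move=> s x _; have [b ->] : exists b, iter_derive (cst a) s = cst b.
  elim: s a => [|v s IH] a; first by exists a.
  suff -> : iter_derive (cst a) (v :: s) = iter_derive (cst 0) s by exact: IH.
  have d0 : 'D_v (cst a : V -> W) = cst 0.
    by apply: funext => y; exact: derive_cst.
  by rewrite /= d0.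
exact: differentiable_cst.
Qed.

Lemma eq_smooth_on (W : normedModType R) (A : set V) (f g : V -> W) :
  open A -> {in A, f =1 g} -> smooth_on A f -> smooth_on A g.
Proof.
move=> oA fg /smooth_onP fs; apply/smooth_onP => k.
exact: (eq_smooth_upto oA fg (fs k)).
Qed.

Lemma smooth_onD (W : normedModType R) (A : set V) (f g : V -> W) :
  open A -> smooth_on A f -> smooth_on A g -> smooth_on A (fun z => f z + g z).
Proof.
move=> oA /smooth_onP fs /smooth_onP gs; apply/smooth_onP => k.
exact: (smooth_uptoD oA (fs k) (gs k)).
Qed.

Lemma smooth_onZ (W : normedModType R) (A : set V) (f : V -> R) (g : V -> W) :
  open A -> smooth_on A f -> smooth_on A g -> smooth_on A (fun z => f z *: g z).
Proof.
move=> oA /smooth_onP fs /smooth_onP gs; apply/smooth_onP => k.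
exact: (smooth_uptoZ oA (fs k) (gs k)).
Qed.

Lemma smooth_onS (W : normedModType R) (A B : set V) (f : V -> W) :
  A `<=` B -> smooth_on B f -> smooth_on A f.
Proof. by move=> AB fs s x /AB; exact: fs. Qed.

End SmoothOn.

(** * Smooth functions and vector fields on a manifold *)

Section Manifold.
Variables (R : realType) (n : nat) (M : smooth_manifold R n).
Implicit Types (U V : set M) (X Y Z : vfield M) (f : M -> R).

(** The closure properties of [smooth_on] need an open set, and smoothness on U
    is tested on these images. *)
Lemma chart_image_open (c : chart R n M) U :
  open U -> open (c @` (U `&` dom c)).
Proof.
move=> oU; rewrite openE => _ [x [Ux dx] <-].
have cx : (c @` dom c) (c x) by exists x.
have := chart_inv_continuous cx.
have /= nx : nbhs (chart_inv c (c x)) (U `&` dom c).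
  rewrite chart_invK //; apply: open_nbhs_nbhs; split=> //.
  by apply: openI (@dom_open _ _ _ c).
move=> /(_ _ nx) n1.
have {}n1 : nbhs (c x) (chart_inv c @^-1` (U `&` dom c)) by exact: n1.
have n2 := open_nbhs_nbhs (conj (@image_open _ _ _ c) cx).
apply: filterS (filterI n1 n2) => z [/= Uz [y dy yz]].
by exists y => //; move: Uz; rewrite -yz chart_invK.
Qed.

Lemma tangent_coord_linear (c : chart R n M) (x : M) :
  atlas c -> dom c x -> linear (tangent_coord c x).
Proof.
move=> ac dx a v w; rewrite /tangent_coord.
have dc : differentiable (c \o chart_inv (chart_at x)) (chart_at x x).
  apply: (@atlas_compatible _ _ M _ _ (chart_at_atlas x) ac [::]).
  by exists x => //; split=> //; exact: dom_chart_at.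
by rewrite !deriveE // linearP.
Qed.

Lemma eq_smooth_fun U f g : open U -> {in U, f =1 g} -> smooth_fun U f ->
  smooth_fun U g.
Proof.
move=> oU fg fs c ac; apply: eq_smooth_on (fs c ac).
  exact: chart_image_open.
move=> _ /set_mem [x [Ux dx] <-] /=; rewrite chart_invK //.
by apply: fg; rewrite inE.
Qed.

Lemma smooth_fun_cst U (a : R) : smooth_fun U (fun=> a).
Proof. move=> c ac; exact: smooth_on_cst. Qed.

Lemma smooth_fun_sum U m (f : 'I_m -> M -> R) : open U ->
  (forall i, smooth_fun U (f i)) -> smooth_fun U (fun y => \sum_i f i y).
Proof.
move=> oU fs; elim: (index_enum _) => [|i r IH].
  by under eq_fun do rewrite big_nil; exact: smooth_fun_cst.
under eq_fun do rewrite big_cons; move=> c ac.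
exact: (smooth_onD (chart_image_open (c := c) oU) (fs i c ac) (IH c ac)).
Qed.

Lemma eq_smooth_vfield U X Y : open U -> {in U, X =1 Y} ->
  smooth_vfield U X -> smooth_vfield U Y.
Proof.
move=> oU XY Xs c ac; apply: eq_smooth_on (Xs c ac).
  exact: chart_image_open.
move=> _ /set_mem [x [Ux dx] <-]; rewrite /chart_rep chart_invK //.
by rewrite XY ?inE.
Qed.

Lemma smooth_vfieldS U V X : U `<=` V -> smooth_vfield V X -> smooth_vfield U X.
Proof.
move=> UV fs c ac; apply: smooth_onS (fs c ac) => _ [x [Ux dx] <-].
by exists x => //; split=> //; exact: UV.
Qed.

Lemma smooth_vfieldD U X Y : open U -> smooth_vfield U X -> smooth_vfield U Y ->
  smooth_vfield U (fun y => X y + Y y).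
Proof.
move=> oU Xs Ys c ac; have oc := chart_image_open (c := c) oU.
apply: eq_smooth_on (smooth_onD oc (Xs c ac) (Ys c ac)) => //.
move=> _ /set_mem [x [Ux dx] <-]; rewrite /chart_rep chart_invK //.
by have := tangent_coord_linear ac dx 1 (X x) (Y x); rewrite !scale1r.
Qed.

Lemma smooth_vfieldZ U f X : open U -> smooth_fun U f -> smooth_vfield U X ->
  smooth_vfield U (fun y => f y *: X y).
Proof.
move=> oU fs Xs c ac; have oc := chart_image_open (c := c) oU.
apply: eq_smooth_on (smooth_onZ oc (fs c ac) (Xs c ac)) => //.
move=> _ /set_mem [x [Ux dx] <-]; rewrite /chart_rep /= chart_invK //.
pose t : {linear _ -> _} := HB.pack (tangent_coord c x)
  (GRing.isLinear.Build _ _ _ _ _ (tangent_coord_linear ac dx)).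
by rewrite -[RHS]/(t _) linearZ.
Qed.

Lemma smooth_vfield0 U : smooth_vfield U (fun=> 0).
Proof.
move=> c ac; rewrite (_ : chart_rep c _ = fun=> 0); first exact: smooth_on_cst.
by apply: funext => y; exact: derive0.
Qed.

Lemma smooth_vfield_sum U m (X : 'I_m -> vfield M) : open U ->
  (forall i, smooth_vfield U (X i)) -> smooth_vfield U (fun y => \sum_i X i y).
Proof.
move=> oU Xs; elim: (index_enum _) => [|i r IH].
  by under eq_fun do rewrite big_nil; exact: smooth_vfield0.
by under eq_fun do rewrite big_cons; exact: smooth_vfieldD.
Qed.

Lemma smooth_vfieldN U X : open U -> smooth_vfield U X ->
  smooth_vfield U (fun y => - X y).
Proof.
move=> oU /(smooth_vfieldZ oU (smooth_fun_cst (-1))).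
by under eq_fun do rewrite scaleN1r.
Qed.

Lemma smooth_vfieldB U X Y : open U -> smooth_vfield U X -> smooth_vfield U Y ->
  smooth_vfield U (fun y => X y - Y y).
Proof. by move=> oU Xs /(smooth_vfieldN oU); exact: smooth_vfieldD. Qed.

Lemma eq_dir_derive U x v f g : open U -> U x -> {in U, f =1 g} ->
  dir_derive x v f = dir_derive x v g.
Proof.
move=> oU Ux fg; apply: near_eq_derive.
apply: (@open_eq_near _ _ (chart_at x @` (U `&` dom (chart_at x)))).
- exact: chart_image_open.
- move=> _ /set_mem [y [Uy dy] <-] /=; rewrite chart_invK //.
  by apply: fg; rewrite inE.
- by exists x => //; split=> //; exact: dom_chart_at.
Qed.

Lemma smooth_fun_derivable U x v f : U x -> smooth_fun U f ->
  derivable (f \o chart_inv (chart_at x)) (chart_at x x) v.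
Proof.
move=> Ux fs; apply: diff_derivable; apply: (fs _ (chart_at_atlas x) [::]).
by exists x => //; split=> //; exact: dom_chart_at.
Qed.

Lemma dir_derive_cst x v (a : R) : dir_derive (M := M) x v (fun=> a) = 0.
Proof. exact: derive_cst. Qed.

Lemma dir_derive_sum U x v m (f : 'I_m -> M -> R) : U x ->
  (forall i, smooth_fun U (f i)) ->
  dir_derive x v (fun y => \sum_i f i y) = \sum_i dir_derive x v (f i).
Proof.
move=> Ux fs; rewrite /dir_derive -derive_sum; last first.
  by move=> i; apply: smooth_fun_derivable (fs i).
by congr derive; apply: funext => y /=; rewrite fct_sumE.
Qed.

Lemma dir_deriveZ U x v (a : R) f : U x -> smooth_fun U f ->
  dir_derive x v (fun y => a * f y) = a * dir_derive x v f.
Proof.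
move=> Ux fs; rewrite /dir_derive -[RHS]/(a *: 'D_v _ _) -deriveZ //.
exact: smooth_fun_derivable fs.
Qed.

End Manifold.

(** * Locality and Leibniz rule of the connection *)

Section Connection.
Variables (R : realType) (n : nat) (M : smooth_manifold R n).
Variables (g : riemannian_metric M) (D : connection M).
Hypothesis lcD : levi_civita g D.
Implicit Types (U V : set M) (X Y Z : vfield M) (f : M -> R).

(** Both fields agree with their product by the indicator function of U, and
    these products are the same field; the Leibniz rule applies to them because
    the indicator function is constant, hence smooth, on U. *)
Lemma eq_conn U x v Y Z : open U -> U x -> smooth_vfield U Y ->
  {in U, Y =1 Z} -> D x v Y = D x v Z.
Proof.
move=> oU Ux Ys YZ; pose f (y : M) : R := (y \in U)%:R.
have Zs := eq_smooth_vfield oU YZ Ys.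
have f1 : {in U, (fun=> 1) =1 f} by move=> y Uy; rewrite /f Uy.
have fs : smooth_fun U f by exact: eq_smooth_fun f1 (smooth_fun_cst 1).
have df : dir_derive x v f = 0.
  by rewrite -(eq_dir_derive v oU Ux f1) dir_derive_cst.
have fx : f x = 1 by rewrite /f mem_set.
have locY W : smooth_vfield U W -> D x v W = D x v (fun y => f y *: W y).
  move=> Ws; rewrite (conn_leibniz lcD v oU Ux fs Ws).
  by rewrite df fx scale0r add0r scale1r.
rewrite (locY _ Ys) (locY _ Zs); congr (D x v _); apply: funext => y.
by rewrite /f; case: (boolP (y \in U)) => [/YZ ->|_] //; rewrite !scale0r.
Qed.

Lemma conn0 x v : D x v (fun=> 0) = 0.
Proof.
have := conn_leibniz lcD v openT (I : [set: M] x) (smooth_fun_cst 0)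
  (smooth_vfield0 (U := setT)).
rewrite dir_derive_cst !scale0r addr0 => D0; rewrite -[RHS]D0.
by congr (D x v _); apply: funext => y; rewrite scale0r.
Qed.

Lemma conn_sum U x v m (Y : 'I_m -> vfield M) : open U -> U x ->
  (forall i, smooth_vfield U (Y i)) ->
  D x v (fun y => \sum_i Y i y) = \sum_i D x v (Y i).
Proof.
move=> oU Ux Ys; suff [_ ->] : smooth_vfield U (fun y => \sum_i Y i y) /\
  D x v (fun y => \sum_i Y i y) = \sum_i D x v (Y i) by [].
elim: (index_enum _) => [|i r [IHs IH]].
  under eq_fun do rewrite big_nil.
  by rewrite big_nil conn0; split=> //; exact: smooth_vfield0.
under eq_fun do rewrite big_cons.
rewrite big_cons; split; first exact: smooth_vfieldD.
by rewrite (conn_add lcD v oU Ux (Ys i) IHs) IH.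
Qed.

Lemma connN U x v Y : open U -> U x -> smooth_vfield U Y ->
  D x v (fun y => - Y y) = - D x v Y.
Proof.
move=> oU Ux Ys.
have := conn_leibniz lcD v oU Ux (smooth_fun_cst (-1)) Ys.
rewrite dir_derive_cst scale0r add0r scaleN1r => <-.
by congr (D x v _); apply: funext => y; rewrite scaleN1r.
Qed.

Lemma connB U x v Y Z : open U -> U x ->
  smooth_vfield U Y -> smooth_vfield U Z ->
  D x v (fun y => Y y - Z y) = D x v Y - D x v Z.
Proof.
move=> oU Ux Ys Zs.
by rewrite (conn_add lcD v oU Ux Ys (smooth_vfieldN oU Zs)) (connN v oU Ux Zs).
Qed.

(** Tensoriality of operators built from D comes from this rule: the terms with
    derivatives of the coefficients have the same shape for every field
    expanded with the same f, and cancel between the parts of the operator. *)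
Lemma conn_expand U x v m (f : 'I_m -> M -> R) (X : 'I_m -> vfield M) Y :
  open U -> U x -> (forall k, smooth_fun U (f k)) ->
  (forall k, smooth_vfield U (X k)) ->
  {in U, forall y, Y y = \sum_k f k y *: X k y} ->
  D x v Y = \sum_k (dir_derive x v (f k) *: X k x + f k x *: D x v (X k)).
Proof.
move=> oU Ux fs Xs YE.
have sX k : smooth_vfield U (fun y => f k y *: X k y) by exact: smooth_vfieldZ.
rewrite -(eq_conn v oU Ux (Y := fun y => \sum_k f k y *: X k y)).
- rewrite (conn_sum v oU Ux sX); apply: eq_bigr => k _.
  exact: (conn_leibniz lcD v oU Ux (fs k) (Xs k)).
- exact: smooth_vfield_sum.
- by move=> y Uy; rewrite YE.
Qed.

End Connection.

(** * Orthonormal bases of a tangent space *)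

Section Multilinear.
Variables (R : realType) (n : nat).

Lemma linear_expand (V W : lmodType R) (f : V -> W) m (a : 'I_m -> R)
    (v : 'I_m -> V) : linear f -> f (\sum_k a k *: v k) = \sum_k a k *: f (v k).
Proof.
move=> lf.
pose F : {linear V -> W} := HB.pack f (GRing.isLinear.Build _ _ _ _ _ lf).
by rewrite -[LHS]/(F _) linear_sum; apply: eq_bigr => k _; rewrite linearZ.
Qed.

Lemma linear_expand2 (V W : lmodType R) (f : V -> W) m (a b : 'I_m -> R)
    (v w : 'I_m -> V) : linear f ->
  f (\sum_k (a k *: v k + b k *: w k))
  = \sum_k (a k *: f (v k) + b k *: f (w k)).
Proof.
move=> lf; rewrite !big_split /= -[X in f (X + _)]scale1r lf scale1r.
by rewrite !(linear_expand _ _ lf).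
Qed.

Lemma linear_scale_sum (V W : lmodType R) m (f : 'I_m -> V -> W)
    (a : 'I_m -> R) :
  (forall k, linear (f k)) -> linear (fun v => \sum_k a k *: f k v).
Proof.
move=> lf b v w; rewrite scaler_sumr -big_split /=; apply: eq_bigr => k _.
by rewrite lf scalerDr !scalerA mulrC.
Qed.

Variables (M : smooth_manifold R n) (g : riemannian_metric M) (x : M).

Lemma metric_linearl w : linear (fun v => g x v w : R^o).
Proof. exact: (metric_linear g x w). Qed.

Lemma metric_linearr v : linear (fun w => g x v w : R^o).
Proof. by move=> a w w'; rewrite !(Defs.metric_sym g x v) metric_linearl. Qed.

Lemma metricBl u v w : g x (u - v) w = g x u w - g x v w.
Proof.
by rewrite addrC -scaleN1r [LHS]metric_linearl [_ *: _]mulN1r addrC.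
Qed.

Lemma metricDl u v w : g x (u + v) w = g x u w + g x v w.
Proof. by rewrite -[u]scale1r [LHS]metric_linearl !scale1r. Qed.

Lemma metricDr u v w : g x u (v + w) = g x u v + g x u w.
Proof. by rewrite !(Defs.metric_sym g x u) metricDl. Qed.

Lemma metric_suml m (u : 'I_m -> 'rV[R]_n) w :
  g x (\sum_i u i) w = \sum_i g x (u i) w.
Proof.
have := linear_expand (fun=> 1) u (metric_linearl w).
by under eq_bigr do rewrite scale1r; under [in RHS]eq_bigr do rewrite scale1r.
Qed.

Definition orthonormal_at (E : 'I_n -> 'rV[R]_n) : Prop :=
  forall i j, g x (E i) (E j) = (i == j)%:R.

(** With P the matrix of v |-> (g(v, E_k))_k and Em that of the rows E_k,
    orthonormality says Em P = 1; for square matrices this gives P Em = 1, which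
    is the expansion. *)
Lemma orthonormal_expand (E : 'I_n -> 'rV[R]_n) (v : 'rV[R]_n) :
  orthonormal_at E -> v = \sum_k g x v (E k) *: E k.
Proof.
move=> oE; pose P := \matrix_(i, k) g x (delta_mx 0 i : 'rV_n) (E k).
pose Em := \matrix_(k, i) E k 0 i.
have gP (w : 'rV[R]_n) k : g x w (E k) = (w *m P) 0 k.
  rewrite [in LHS](row_sum_delta w) [LHS](linear_expand _ _ (metric_linearl _)).
  by rewrite mxE; apply: eq_bigr => i _; rewrite mxE.
have EP : Em *m P = 1%:M.
  apply/matrixP => i k; rewrite -[LHS]/((Em *m P) i k) mxE.
  have -> : \sum_j Em i j * P j k = (E i *m P) 0 k.
    by rewrite mxE; apply: eq_bigr => j _; rewrite mxE.
  by rewrite -gP oE mxE.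
have PE : P *m Em = 1%:M by exact: mulmx1C.
rewrite -[LHS]mulmx1 -PE mulmxA mulmx_sum_row; apply: eq_bigr => k _.
rewrite -gP; by congr (_ *: _); apply/rowP => i; rewrite !mxE.
Qed.

Variables (W : lmodType R) (B : 'rV[R]_n -> 'rV[R]_n -> W).
Hypotheses (Bl : forall w, linear (B ^~ w)) (Br : forall v, linear (B v)).

(** Both traces equal the sum over i, j of g(F_i, E_j) B(E_j, F_i): expand the
    left argument F_i of one in E, and the right argument E_j of the other
    in F. *)
Lemma trace_orthonormal (E F : 'I_n -> 'rV[R]_n) :
  orthonormal_at E -> orthonormal_at F ->
  \sum_i B (F i) (F i) = \sum_i B (E i) (E i).
Proof.
move=> oE oF.
have FE i : B (F i) (F i) = \sum_j g x (F i) (E j) *: B (E j) (F i).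
  by rewrite {1}(orthonormal_expand (F i) oE) (linear_expand _ _ (Bl _)).
have EF j : B (E j) (E j) = \sum_i g x (F i) (E j) *: B (E j) (F i).
  rewrite {2}(orthonormal_expand (E j) oF) (linear_expand _ _ (Br _)).
  by apply: eq_bigr => i _; rewrite Defs.metric_sym.
under eq_bigr do rewrite FE; under [RHS]eq_bigr do rewrite EF.
by rewrite exchange_big.
Qed.

(** Expanding A_j in E, the sum pairs the skew matrix g(A_j, E_k) with the
    symmetric matrix B(E_k, E_j) + B(E_j, E_k). It is used with A_j the
    derivative of the j-th frame field. *)
Lemma trace_skew (E A : 'I_n -> 'rV[R]_n) : orthonormal_at E ->
  (forall j k, g x (A j) (E k) + g x (E j) (A k) = 0) ->
  \sum_j (B (A j) (E j) + B (E j) (A j)) = 0.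
Proof.
move=> oE skew.
have Al j : B (A j) (E j) = \sum_k g x (A j) (E k) *: B (E k) (E j).
  by rewrite {1}(orthonormal_expand (A j) oE) (linear_expand _ _ (Bl _)).
have Ar j : B (E j) (A j) = \sum_k g x (A j) (E k) *: B (E j) (E k).
  by rewrite {1}(orthonormal_expand (A j) oE) (linear_expand _ _ (Br _)).
under eq_bigr do rewrite Al Ar.
rewrite big_split /= [X in _ + X]exchange_big /=.
rewrite -big_split big1 //= => j _; rewrite -big_split big1 //= => k _.
by rewrite -scalerDl (Defs.metric_sym g x (A k)) skew scale0r.
Qed.

End Multilinear.

(** * Covariant derivative of a tensor of type (1, 2) *)

Section CovTensor.
Variables (R : realType) (n : nat) (M : smooth_manifold R n).
Variables (g : riemannian_metric M) (D : connection M).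
Hypothesis lcD : levi_civita g D.
Variables (U : set M) (e : 'I_n -> vfield M).
Hypotheses (openU : open U) (frame_e : orthonormal_frame g U e).
Implicit Types (V : set M) (X Y Z : vfield M).

Let e_smooth V i : V `<=` U -> smooth_vfield V (e i).
Proof. by move=> VU; exact: smooth_vfieldS VU (frame_e.1 i). Qed.

Let e_orth y : U y -> orthonormal_at g y (e ^~ y).
Proof. by move=> Uy i j; exact: frame_e.2. Qed.

(** Derivative of the constant g(e_j, e_k). *)
Lemma frame_skew x u j k : U x ->
  g x (D x u (e j)) (e k x) + g x (e j x) (D x u (e k)) = 0.
Proof.
move=> Ux; rewrite -(conn_metric lcD u openU Ux (frame_e.1 j) (frame_e.1 k)).
rewrite (eq_dir_derive (g := fun=> (j == k)%:R) u openU Ux).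
  exact: dir_derive_cst.
by move=> y /set_mem Uy; exact: frame_e.2.
Qed.

Lemma coef_smooth V Y k : open V -> V `<=` U -> smooth_vfield V Y ->
  smooth_fun V (fun y => g y (Y y) (e k y)).
Proof. by move=> oV VU Ys; exact: (metric_smooth g oV Ys (e_smooth k VU)). Qed.

Definition tensor2_on (B : M -> 'rV[R]_n -> 'rV[R]_n -> 'rV[R]_n) : Prop :=
  [/\ forall y w, U y -> linear (B y ^~ w),
      forall y v, U y -> linear (B y v) &
      forall V Y Z, open V -> V `<=` U -> smooth_vfield V Y ->
        smooth_vfield V Z -> smooth_vfield V (fun y => B y (Y y) (Z y))].

Definition cov_tensor2 (B : M -> 'rV[R]_n -> 'rV[R]_n -> 'rV[R]_n) (x : M)
    (u : 'rV[R]_n) Y Z : 'rV[R]_n :=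
  D x u (fun y => B y (Y y) (Z y)) - B x (D x u Y) (Z x) - B x (Y x) (D x u Z).

(** The derivatives of the coefficients of Y enter through D (B(Y, Z)) and
    through B(D Y, Z) with opposite signs. *)
Lemma cov_tensor2_expandl B V x u Y Z : tensor2_on B -> open V -> V `<=` U ->
  V x -> smooth_vfield V Y -> smooth_vfield V Z ->
  cov_tensor2 B x u Y Z
  = \sum_k g x (Y x) (e k x) *: cov_tensor2 B x u (e k) Z.
Proof.
move=> [Bl Br Bs] oV VU Vx Ys Zs; pose f k y := g y (Y y) (e k y).
have fs k : smooth_fun V (f k) by exact: coef_smooth.
have YE y : V y -> Y y = \sum_k f k y *: e k y.
  by move=> /VU Uy; exact: orthonormal_expand (e_orth Uy).
have Ux := VU _ Vx; have es k := e_smooth k VU.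
have Bes k := Bs V (e k) Z oV VU (es k) Zs.
have BE : {in V, forall y,
    B y (Y y) (Z y) = \sum_k f k y *: B y (e k y) (Z y)}.
  move=> y /set_mem Vy; rewrite {1}YE //.
  exact: linear_expand (Bl y (Z y) (VU _ Vy)).
have YE' : {in V, forall y, Y y = \sum_k f k y *: e k y}.
  by move=> y /set_mem; exact: YE.
rewrite /cov_tensor2 (conn_expand lcD u oV Vx fs Bes BE).
rewrite (conn_expand lcD u oV Vx fs es YE').
rewrite (linear_expand2 _ _ _ _ (Bl x (Z x) Ux)) {1}[Y x]YE //.
rewrite (linear_expand _ _ (Bl x (D x u Z) Ux)) -!sumrB.
by apply: eq_bigr => k _; rewrite !scalerBr opprD addrACA subrr add0r.
Qed.

Lemma tensor2_on_swap B : tensor2_on B -> tensor2_on (fun y v w => B y w v).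
Proof.
move=> [Bl Br Bs]; split; [exact: Br|exact: Bl|].
by move=> V Y Z oV VU Ys Zs; exact: (Bs V Z Y oV VU Zs Ys).
Qed.

Lemma cov_tensor2_swap B x u Y Z :
  cov_tensor2 B x u Y Z = cov_tensor2 (fun y v w => B y w v) x u Z Y.
Proof. by rewrite /cov_tensor2 addrAC. Qed.

(** D B as a trilinear map of tangent vectors at x; [cov_tensor2E] relates it to
    the operator on vector fields. *)
Definition cov_tensor2_at B x u v w : 'rV[R]_n :=
  \sum_k g x v (e k x) *:
    \sum_l g x w (e l x) *: cov_tensor2 B x u (e k) (e l).

Lemma cov_tensor2E B V x u Y Z : tensor2_on B -> open V -> V x -> U x ->
  smooth_vfield V Y -> smooth_vfield V Z ->
  cov_tensor2 B x u Y Z = cov_tensor2_at B x u (Y x) (Z x).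
Proof.
move=> tB oV Vx Ux Ys Zs; have oW := openI oV openU.
have WU : V `&` U `<=` U by move=> y [].
have WV : V `&` U `<=` V by move=> y [].
have [Ys' Zs'] := (smooth_vfieldS WV Ys, smooth_vfieldS WV Zs).
rewrite (cov_tensor2_expandl u tB oW WU (conj Vx Ux) Ys' Zs').
apply: eq_bigr => k _; congr (_ *: _); rewrite cov_tensor2_swap.
rewrite (cov_tensor2_expandl u (tensor2_on_swap tB) oW WU (conj Vx Ux) Zs'
  (e_smooth k WU)).
by apply: eq_bigr => l _; rewrite [in RHS]cov_tensor2_swap.
Qed.

Lemma cov_tensor2_at_linear1 B x v w : tensor2_on B -> U x ->
  linear (fun u => cov_tensor2_at B x u v w).
Proof.
move=> [Bl Br Bs] Ux.
apply: linear_scale_sum => k; apply: linear_scale_sum => l.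
move=> a u u'; rewrite /cov_tensor2.
have sm i : smooth_vfield U (e i) := frame_e.1 i.
have sB := Bs U _ _ openU (subset_refl (A := U)) (sm k) (sm l).
rewrite (conn_linear lcD openU Ux sB) !(conn_linear lcD openU Ux (sm _)).
rewrite Bl // Br //.
by rewrite !scalerBr !opprD (addrACA (a *: D x u _)) [LHS]addrACA.
Qed.

Lemma cov_tensor2_at_linear2 B x u w :
  linear (fun v => cov_tensor2_at B x u v w).
Proof.
move=> a v v'; rewrite /cov_tensor2_at scaler_sumr -big_split /=.
apply: eq_bigr => k _; rewrite scalerA -scalerDl; congr (_ *: _).
exact: (metric_linearl g x (e k x)).
Qed.

Lemma cov_tensor2_at_linear3 B x u v : linear (cov_tensor2_at B x u v).
Proof.
apply: linear_scale_sum => k a w w'; rewrite scaler_sumr -big_split /=.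
apply: eq_bigr => l _; rewrite scalerA -scalerDl; congr (_ *: _).
exact: (metric_linearl g x (e l x)).
Qed.

End CovTensor.

(** * First and second covariant derivatives of J *)

Section Bochner.
Variables (R : realType) (n : nat) (M : smooth_manifold R n).
Variables (g : riemannian_metric M) (D : connection M).
Hypothesis lcD : levi_civita g D.
Variables (U : set M) (e : 'I_n -> vfield M).
Hypotheses (openU : open U) (frame_e : orthonormal_frame g U e).
Variable (J : endo_field M).
Hypothesis smoothJ : forall (V : set M) (X : vfield M), open V ->
  smooth_vfield V X -> smooth_vfield V (endo_apply J X).
Implicit Types (V : set M) (X Y Z : vfield M).

Let e_smooth V i : V `<=` U -> smooth_vfield V (e i).
Proof. by move=> VU; exact: smooth_vfieldS VU (frame_e.1 i). Qed.

Let e_orth y : U y -> orthonormal_at g y (e ^~ y).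
Proof. by move=> Uy i j; exact: frame_e.2. Qed.

(** (D_u J)(w) on tangent vectors, expanded in the frame e so that it is
    bilinear by construction; [nabla_endoE] says that it is what the operator on
    vector fields computes. *)
Definition nabla_endo (y : M) (u w : 'rV[R]_n) : 'rV[R]_n :=
  \sum_k g y w (e k y) *: (D y u (endo_apply J (e k)) - J y (D y u (e k))).

Lemma nabla_endoE V y u Z : open V -> V y -> U y -> smooth_vfield V Z ->
  D y u (endo_apply J Z) - J y (D y u Z) = nabla_endo y u (Z y).
Proof.
move=> oV Vy Uy Zs; have oW := openI oV openU.
have WU : V `&` U `<=` U by move=> z [].
have WV : V `&` U `<=` V by move=> z [].
have Zs' := smooth_vfieldS WV Zs.
pose f k z := g z (Z z) (e k z).
have fs k : smooth_fun (V `&` U) (f k) := coef_smooth frame_e k oW WU Zs'.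
have es k := e_smooth k WU.
have Jes k := smoothJ oW (es k).
have ZE : {in V `&` U, forall z, Z z = \sum_k f k z *: e k z}.
  by move=> z /set_mem [_ Uz]; exact: orthonormal_expand (e_orth Uz).
have JZE : {in V `&` U, forall z,
    endo_apply J Z z = \sum_k f k z *: endo_apply J (e k) z}.
  move=> z Wz; rewrite {1}/endo_apply (ZE z Wz) linear_sum.
  by apply: eq_bigr => k _; rewrite linearZ.
rewrite (conn_expand lcD u oW (conj Vy Uy) fs Jes JZE).
rewrite (conn_expand lcD u oW (conj Vy Uy) fs es ZE).
rewrite linear_sum -sumrB; apply: eq_bigr => k _.
by rewrite linearD !linearZ /= opprD addrACA subrr add0r scalerBr.
Qed.

Lemma nabla_endo_linear1 y w : U y -> linear (nabla_endo y ^~ w).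
Proof.
move=> Uy; apply: linear_scale_sum => k a u u'.
have es := frame_e.1 k.
rewrite (conn_linear lcD openU Uy (smoothJ openU es)).
rewrite (conn_linear lcD openU Uy es).
by rewrite linearP scalerBr opprD addrACA.
Qed.

Lemma nabla_endo_linear2 y u : linear (nabla_endo y u).
Proof.
move=> a w w'; rewrite /nabla_endo scaler_sumr -big_split /=.
apply: eq_bigr => k _; rewrite scalerA -scalerDl; congr (_ *: _).
exact: (metric_linearl g y (e k y)).
Qed.

Lemma nabla_endo_field V Y Z : open V -> V `<=` U -> smooth_vfield V Z ->
  {in V, (fun y => cov D Y (endo_apply J Z) y - endo_apply J (cov D Y Z) y)
         =1 (fun y => nabla_endo y (Y y) (Z y))}.
Proof.
by move=> oV VU Zs y /set_mem Vy; exact: (nabla_endoE (Y y) oV Vy (VU _ Vy) Zs).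
Qed.

Lemma nabla_endo_tensor : tensor2_on U nabla_endo.
Proof.
split; [by move=> y w; exact: nabla_endo_linear1| |].
  by move=> y v _; exact: nabla_endo_linear2.
move=> V Y Z oV VU Ys Zs.
apply: (eq_smooth_vfield oV (nabla_endo_field Y oV VU Zs)).
apply: (smooth_vfieldB oV).
  exact: (conn_smooth lcD oV Ys (smoothJ oV Zs)).
exact: (smoothJ oV (conn_smooth lcD oV Ys Zs)).
Qed.

(** D^2_{u,Y} J (Z). *)
Definition hess_endo := cov_tensor2 D nabla_endo.

(** Expand both second derivatives into iterated derivatives. The mixed terms
    D_X (J (D_Y Z)) and D_Y (J (D_X Z)) appear symmetrically in X and Y and
    cancel; the terms with D_(D_X Y) and D_(D_Y X) combine to D_[X,Y] because D
    is torsion-free. *)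
Lemma ricci_identity V x X Y Z : open V -> V `<=` U -> V x ->
  smooth_vfield V X -> smooth_vfield V Y -> smooth_vfield V Z ->
  hess_endo x (X x) Y Z - hess_endo x (Y x) X Z
  = - curvature D X Y (endo_apply J Z) x
    + endo_apply J (curvature D X Y Z) x.
Proof.
move=> oV VU Vx Xs Ys Zs.
have Ux := VU _ Vx.
have JZs := smoothJ oV Zs.
have H A B : smooth_vfield V A -> smooth_vfield V B ->
  hess_endo x (A x) B Z = cov D A (cov D B (endo_apply J Z)) x
    - cov D A (endo_apply J (cov D B Z)) x
    - (D x (cov D A B x) (endo_apply J Z) - J x (D x (cov D A B x) Z))
    - (cov D B (endo_apply J (cov D A Z)) x - J x (cov D B (cov D A Z) x)).
  move=> As Bs; rewrite /hess_endo /cov_tensor2.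
  have DZs := conn_smooth lcD oV As Zs.
  have DBZs := conn_smooth lcD oV Bs Zs.
  have DBJZs := conn_smooth lcD oV Bs JZs.
  have JDBZs := smoothJ oV DBZs.
  rewrite -(nabla_endoE (D x (A x) B) oV Vx Ux Zs).
  rewrite -(nabla_endoE (B x) oV Vx Ux DZs).
  rewrite -(eq_conn lcD (A x) oV Vx (smooth_vfieldB oV DBJZs JDBZs)
    (nabla_endo_field B oV VU Zs)).
  by rewrite (connB lcD (A x) oV Vx DBJZs JDBZs).
rewrite (H X Y Xs Ys) (H Y X Ys Xs).
have tor : lie_bracket X Y x = cov D X Y x - cov D Y X x.
  by rewrite (conn_torsion_free lcD oV Vx Xs Ys).
have lin W : smooth_vfield V W ->
    cov D (lie_bracket X Y) W x = D x (cov D X Y x) W - D x (cov D Y X x) W.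
  move=> Ws; rewrite /cov tor -scaleN1r addrC.
  by rewrite (conn_linear lcD oV Vx Ws) scaleN1r addrC.
rewrite -[endo_apply J (curvature D X Y Z) x]/(J x (curvature D X Y Z x)).
have Jlin a b c d : J x (- a + b + (c - d)) = - J x a + J x b + (J x c - J x d).
  by rewrite !linearD !linearN.
rewrite /curvature (lin _ JZs) (lin _ Zs) Jlin.
by apply/rowP => i; rewrite !mxE; ring.
Qed.

Local Notation nJ := nabla_endo.
Local Notation hJ := hess_endo.

(** * The Hodge-Laplacian of J *)

Lemma frame_atP y : U y ->
  exists V, [/\ open V, V y & orthonormal_frame g V (frame_at g y)].
Proof.
move=> Uy; rewrite /frame_at.
set P := [set e0 : {classic 'I_n -> vfield M} | _].
have : P (xget (fun _ _ => 0) P) by apply: xgetPex; exists e; exists U.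
by [].
Qed.

Lemma cov_form_endo V y X (Xs : 'I_1 -> vfield M) : open V -> V y -> U y ->
  smooth_vfield V (Xs ord0) ->
  cov_form D X (endo_form J) Xs y = nJ y (X y) (Xs ord0 y).
Proof.
move=> oV Vy Uy Zs; rewrite /cov_form big_ord1 /endo_form eqxx.
exact: (nabla_endoE (X y) oV Vy Uy Zs).
Qed.

(** The frame in which the codifferential is computed varies with y without any
    regularity; passing to e shows that the codifferential is a smooth field,
    which can then be differentiated. *)
Lemma codiff_endo y (Xs : 'I_0 -> vfield M) : U y ->
  codiff g D (endo_form J) Xs y = - \sum_i nJ y (e i y) (e i y).
Proof.
move=> Uy; rewrite /codiff; have [V [oV Vy [Fs Fo]]] := frame_atP Uy.
congr (- _).
rewrite -(trace_orthonormal (B := nJ y) (fun w => nabla_endo_linear1 w Uy)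
  (@nabla_endo_linear2 y) (e_orth Uy) (Fo y Vy)).
apply: eq_bigr => i _.
have cE : cons_fields (frame_at g y i) Xs ord0 = frame_at g y i.
  by rewrite /cons_fields unlift_none.
have Fi : smooth_vfield V (cons_fields (frame_at g y i) Xs ord0).
  by rewrite cE; exact: Fs.
by rewrite (cov_form_endo (frame_at g y i) oV Vy Uy Fi) cE.
Qed.

(** The derivative also falls on the two entries e_i of N(e_i, e_i); these terms
    vanish by skewness. *)
Lemma ext_deriv_codiff x (Xs : 'I_1 -> vfield M) : U x ->
  ext_deriv D (codiff g D (endo_form J)) Xs x
  = - \sum_i hJ x (Xs ord0 x) (e i) (e i).
Proof.
move=> Ux; rewrite /ext_deriv big_ord1 expr0 scale1r /cov_form big_ord0 subr0.
rewrite /cov; set u := Xs ord0 x.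
have [_ _ nJs] := nabla_endo_tensor.
have sm i : smooth_vfield U (fun y => nJ y (e i y) (e i y)).
  exact: (nJs U _ _ openU (subset_refl (A := U)) (frame_e.1 i) (frame_e.1 i)).
have ssm := smooth_vfield_sum openU sm.
rewrite -(eq_conn lcD u openU Ux (smooth_vfieldN openU ssm)); last first.
  by move=> y /set_mem Uy; rewrite codiff_endo.
rewrite (connN lcD u openU Ux ssm) (conn_sum lcD u openU Ux sm); congr (- _).
have sk := trace_skew (B := nJ x) (fun w => nabla_endo_linear1 w Ux)
  (@nabla_endo_linear2 x) (e_orth Ux)
  (fun j k => frame_skew lcD openU frame_e u j k Ux).
rewrite -[LHS]subr0 -[X in _ - X = _]sk -sumrB; apply: eq_bigr => i _.
by rewrite /hess_endo /cov_tensor2 opprD addrA.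
Qed.

Let i1 : 'I_2 := lift ord0 ord0.

Lemma ext_deriv_endo V y (Ys : 'I_2 -> vfield M) : open V -> V y -> U y ->
  smooth_vfield V (Ys ord0) -> smooth_vfield V (Ys i1) ->
  ext_deriv D (endo_form J) Ys y
  = nJ y (Ys ord0 y) (Ys i1 y) - nJ y (Ys i1 y) (Ys ord0 y).
Proof.
move=> oV Vy Uy Y0s Y1s; rewrite /ext_deriv big_ord_recl big_ord1.
have l1 : lift i1 (ord0 : 'I_1) = ord0 by exact: val_inj.
rewrite expr0 scale1r expr1 scaleN1r.
have Y0s' : smooth_vfield V ((fun j => Ys (lift i1 j)) (ord0 : 'I_1)).
  by rewrite l1.
rewrite (cov_form_endo (Ys ord0) oV Vy Uy Y1s
  (Xs := fun j => Ys (lift ord0 j))).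
by rewrite (cov_form_endo (Ys i1) oV Vy Uy Y0s') l1.
Qed.

Lemma cov_form_ext V x X (Ys : 'I_2 -> vfield M) : open V -> V `<=` U -> V x ->
  smooth_vfield V X -> smooth_vfield V (Ys ord0) -> smooth_vfield V (Ys i1) ->
  cov_form D X (ext_deriv D (endo_form J)) Ys x
  = hJ x (X x) (Ys ord0) (Ys i1) - hJ x (X x) (Ys i1) (Ys ord0).
Proof.
move=> oV VU Vx Xs Y0s Y1s; have Ux := VU _ Vx.
have [_ _ nJs] := nabla_endo_tensor.
have s01 := nJs V _ _ oV VU Y0s Y1s; have s10 := nJs V _ _ oV VU Y1s Y0s.
rewrite /cov_form big_ord_recl big_ord1 -/i1 {1}/cov.
rewrite -(eq_conn lcD (X x) oV Vx (smooth_vfieldB oV s01 s10)); last first.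
  by move=> y /set_mem Vy; rewrite (ext_deriv_endo oV Vy (VU _ Vy) Y0s Y1s).
rewrite (connB lcD (X x) oV Vx s01 s10).
have D0s := conn_smooth lcD oV Xs Y0s; have D1s := conn_smooth lcD oV Xs Y1s.
rewrite (ext_deriv_endo oV Vx Ux D0s Y1s
  (Ys := fun k => if k == ord0 then cov D X (Ys ord0) else Ys k)).
rewrite (ext_deriv_endo oV Vx Ux Y0s D1s
  (Ys := fun k => if k == i1 then cov D X (Ys i1) else Ys k)).
rewrite /= /hess_endo /cov_tensor2 /cov.
by apply/rowP => i; rewrite !mxE; ring.
Qed.

(** The chosen frame at x is traded for e through the bilinear map B, which is
    the summand as a function of the two frame vectors. *)
Lemma codiff_ext V x (Xs : 'I_1 -> vfield M) : open V -> V x -> U x ->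
  smooth_vfield V (Xs ord0) ->
  codiff g D (ext_deriv D (endo_form J)) Xs x
  = - \sum_i (hJ x (e i x) (e i) (Xs ord0) - hJ x (e i x) (Xs ord0) (e i)).
Proof.
move=> oV Vx Ux Zs; rewrite /codiff.
have [V' [oV' V'x [Fs Fo]]] := frame_atP Ux.
congr (- _); set Z := Xs ord0 in Zs *; pose W := V `&` V' `&` U.
have oW : open W := openI (openI oV oV') openU.
have Wx : W x by [].
have WU : W `<=` U by move=> y [].
have Zs' : smooth_vfield W Z by apply: smooth_vfieldS Zs => y [[]].
have Fs' i : smooth_vfield W (frame_at g x i).
  by apply: smooth_vfieldS (Fs i) => y [[]].
pose T u v w := cov_tensor2_at g D e nJ x u v w.
have hE u Y Y' : smooth_vfield W Y -> smooth_vfield W Y' ->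
    hJ x u Y Y' = T u (Y x) (Y' x).
  move=> Ys Ys'.
  exact: (cov_tensor2E lcD openU frame_e u nabla_endo_tensor oW Wx Ux Ys Ys').
have T1 v w : linear (fun u => T u v w) :=
  cov_tensor2_at_linear1 lcD openU frame_e v w nabla_endo_tensor Ux.
have T2 u w : linear (fun v => T u v w) :=
  cov_tensor2_at_linear2 g D e nJ x u w.
have T3 u v : linear (T u v) := cov_tensor2_at_linear3 g D e nJ x u v.
pose B u v := T u v (Z x) - T u (Z x) v.
have Bl w : linear (B ^~ w).
  by move=> a u u'; rewrite /B T1 T1 scalerBr opprD addrACA.
have Br v : linear (B v).
  by move=> a u u'; rewrite /B T2 T3 scalerBr opprD addrACA.
transitivity (\sum_i B (e i x) (e i x)).
  rewrite -(trace_orthonormal Bl Br (e_orth Ux) (Fo x V'x)).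
  apply: eq_bigr => i _.
  set Ys := cons_fields _ _.
  have Y0 : Ys ord0 = frame_at g x i by rewrite /Ys /cons_fields unlift_none.
  have Y1 : Ys i1 = Z by rewrite /Ys /cons_fields liftK.
  rewrite (cov_form_ext oW WU Wx (Fs' i)) ?Y0 ?Y1; [|exact: Fs'|exact: Zs'].
  by rewrite (hE _ _ _ (Fs' i) Zs') (hE _ _ _ Zs' (Fs' i)).
apply: eq_bigr => i _.
by rewrite (hE _ _ _ (e_smooth i WU) Zs') (hE _ _ _ Zs' (e_smooth i WU)).
Qed.

(** * The Hessian of the energy density *)

Let nJs V Y Z := let: And3 _ _ s := nabla_endo_tensor in s V Y Z.
Local Notation energy := (energy_density g J).
Let JJ y (v w : 'rV[R]_n) : R^o := g y (J y v) (J y w).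

Let JJl y w : linear (JJ y ^~ w).
Proof. by move=> a v v'; rewrite /JJ linearP; exact: metric_linearl. Qed.

Let JJr y v : linear (JJ y v).
Proof. by move=> a w w'; rewrite /JJ linearP; exact: metric_linearr. Qed.

Lemma energy_densityE y : U y -> energy y = 2^-1 * \sum_j JJ y (e j y) (e j y).
Proof.
move=> Uy; rewrite /energy_density.
have [V [oV Vy [_ Fo]]] := frame_atP Uy.
by rewrite -(trace_orthonormal (JJl y) (JJr y) (e_orth Uy) (Fo y Vy)).
Qed.

Lemma conn_endo y u Z V : open V -> V y -> U y -> smooth_vfield V Z ->
  D y u (endo_apply J Z) = nJ y u (Z y) + J y (D y u Z).
Proof. by move=> oV Vy Uy Zs; rewrite -(nabla_endoE u oV Vy Uy Zs) subrK. Qed.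

(** By D_v (J e_j) = N(v, e_j) + J (D_v e_j), where the second term contributes
    nothing after summation, by skewness for the form <J., J.>. *)
Lemma dir_derive_energy y v : U y ->
  dir_derive y v energy = \sum_j g y (nJ y v (e j y)) (endo_apply J (e j) y).
Proof.
move=> Uy; have Jes j := smoothJ openU (frame_e.1 j).
have fs j := metric_smooth g openU (Jes j) (Jes j).
rewrite (eq_dir_derive v openU Uy (g := fun y => 2^-1 *
  \sum_j g y (endo_apply J (e j) y) (endo_apply J (e j) y))); last first.
  by move=> z /set_mem Uz; exact: energy_densityE.
rewrite (dir_deriveZ v _ Uy (smooth_fun_sum openU fs)).
rewrite (dir_derive_sum v Uy fs).
have sk :
    \sum_j (JJ y (D y v (e j)) (e j y) + JJ y (e j y) (D y v (e j))) = 0 :=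
  trace_skew (JJl y) (JJr y) (e_orth Uy)
  (fun j k => frame_skew lcD openU frame_e v j k Uy).
set S := RHS; suff -> : \sum_j dir_derive y v
    (fun y0 => g y0 (endo_apply J (e j) y0) (endo_apply J (e j) y0))
    = 2 * S + \sum_j (JJ y (D y v (e j)) (e j y) + JJ y (e j y) (D y v (e j))).
  by rewrite sk addr0 mulKf // pnatr_eq0.
rewrite /S mulr_sumr -big_split /=; apply: eq_bigr => j _.
rewrite (conn_metric lcD v openU Uy (Jes j) (Jes j)).
rewrite (conn_endo v openU Uy Uy (frame_e.1 j)) metricDl metricDr.
rewrite (Defs.metric_sym g y (endo_apply J (e j) y) (nJ y v (e j y))).
rewrite /JJ /endo_apply; ring.
Qed.

(** Differentiate the sum of [dir_derive_energy]. The derivative of N(Y, e_j) is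
    H(u, Y, e_j) + N(D_u Y, e_j) + N(Y, D_u e_j); the second term is the
    derivative of the energy along D_u Y, and the third one cancels against the
    part J (D_u e_j) of D_u (J e_j), by skewness for <N(Y, .), J.>. *)
Lemma hess_energy V x u Y : open V -> V `<=` U -> V x -> smooth_vfield V Y ->
  dir_derive x u (fun y => dir_derive y (Y y) energy)
    - dir_derive x (D x u Y) energy
  = \sum_j (g x (hJ x u Y (e j)) (J x (e j x))
            + g x (nJ x (Y x) (e j x)) (nJ x u (e j x))).
Proof.
move=> oV VU Vx Ys; have Ux := VU _ Vx.
have es j := e_smooth j VU.
have Jes j := smoothJ oV (es j).
have ns j := nJs oV VU Ys (es j).
have fs j := metric_smooth g oV (ns j) (Jes j).
rewrite (eq_dir_derive u oV Vx (g := fun y =>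
  \sum_j g y (nJ y (Y y) (e j y)) (endo_apply J (e j) y))); last first.
  by move=> z /set_mem Vz; exact: dir_derive_energy (VU _ Vz).
rewrite (dir_derive_sum u Vx fs) (dir_derive_energy _ Ux).
pose B v w : R^o := g x (nJ x (Y x) v) (J x w).
have Bl w : linear (B ^~ w).
  by move=> a v v'; rewrite /B nabla_endo_linear2; exact: metric_linearl.
have Br v : linear (B v).
  by move=> a w w'; rewrite /B linearP; exact: metric_linearr.
have sk : \sum_j (B (D x u (e j)) (e j x) + B (e j x) (D x u (e j))) = 0 :=
  trace_skew Bl Br (e_orth Ux)
  (fun j k => frame_skew lcD openU frame_e u j k Ux).
rewrite -[LHS]subr0 -[X in _ - X = _]sk -!sumrB; apply: eq_bigr => j _.
rewrite (conn_metric lcD u oV Vx (ns j) (Jes j)).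
rewrite (conn_endo u oV Vx Ux (es j)) metricDr /B.
rewrite /hess_endo /cov_tensor2 !metricBl /endo_apply; ring.
Qed.

Lemma laplacian_energy x : U x ->
  laplacian g D energy x = \sum_i \sum_j
    (g x (hJ x (e i x) (e i) (e j)) (J x (e j x))
     + g x (nJ x (e i x) (e j x)) (nJ x (e i x) (e j x))).
Proof.
move=> Ux; rewrite /laplacian; have [V [oV Vx [Fs Fo]]] := frame_atP Ux.
pose W := V `&` U.
have oW : open W := openI oV openU.
have Wx : W x by [].
have WU : W `<=` U by move=> y [].
have Fs' i : smooth_vfield W (frame_at g x i).
  by apply: smooth_vfieldS (Fs i) => y [].
pose T u v w := cov_tensor2_at g D e nJ x u v w.
have hE u Y Y' : smooth_vfield W Y -> smooth_vfield W Y' ->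
    hJ x u Y Y' = T u (Y x) (Y' x).
  move=> Ys Ys'.
  exact: (cov_tensor2E lcD openU frame_e u nabla_endo_tensor oW Wx Ux Ys Ys').
have T1 v w : linear (fun u => T u v w) :=
  cov_tensor2_at_linear1 lcD openU frame_e v w nabla_endo_tensor Ux.
have T2 u w : linear (fun v => T u v w) :=
  cov_tensor2_at_linear2 g D e nJ x u w.
pose B u v : R^o := \sum_j (g x (T u v (e j x)) (J x (e j x))
  + g x (nJ x v (e j x)) (nJ x u (e j x))).
have Bl w : linear (B ^~ w).
  move=> a u u'; rewrite /B scaler_sumr -big_split; apply: eq_bigr => j _ /=.
  rewrite T1 (nabla_endo_linear1 (e j x) Ux).
  rewrite [X in X + _]metric_linearl [X in _ + X]metric_linearr.
  by rewrite scalerDr addrACA.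
have Br v : linear (B v).
  move=> a u u'; rewrite /B scaler_sumr -big_split; apply: eq_bigr => j _ /=.
  rewrite T2 (nabla_endo_linear1 (e j x) Ux).
  rewrite [X in X + _]metric_linearl [X in _ + X]metric_linearl.
  by rewrite scalerDr addrACA.
transitivity (\sum_i B (e i x) (e i x)).
  rewrite -(trace_orthonormal Bl Br (e_orth Ux) (Fo x Vx)).
  apply: eq_bigr => i _.
  rewrite [LHS](hess_energy (frame_at g x i x) oW WU Wx (Fs' i)).
  by apply: eq_bigr => j _; rewrite (hE _ _ _ (Fs' i) (e_smooth j WU)).
apply: eq_bigr => i _; apply: eq_bigr => j _.
by rewrite (hE _ _ _ (e_smooth i WU) (e_smooth j WU)).
Qed.

End Bochner.

(** * The Bochner formula *)

Theorem proposition3p2 (R : realType) (n : nat) (M : smooth_manifold R n)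
    (g : riemannian_metric M) (D : connection M) (J : endo_field M)
    (cptM : compact [set: M]) (lcD : levi_civita g D)
    (harmJ : harmonic_complex_structure g D J)
    (U : set M) (openU : open U) (e : 'I_n -> vfield M)
    (frame_e : orthonormal_frame g U e) (x : M) (Ux : U x) :
  laplacian g D (energy_density g J) x
  = \sum_(i < n) \sum_(j < n)
      (let DJ := cov_form D (e i) (endo_form J) (fun _ => e j) x in
       g x DJ DJ)
    - \sum_(i < n) \sum_(j < n)
        g x (curvature D (e i) (e j) (endo_apply J (e i)) x)
            (endo_apply J (e j) x)
    + \sum_(i < n) \sum_(j < n)
        g x (endo_apply J (curvature D (e i) (e j) (e i)) x)
            (endo_apply J (e j) x).
Proof.
have [[smoothJ _] harm] := harmJ.
pose h := hess_endo g D e J.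
have es i : smooth_vfield U (e i) := frame_e.1 i.
(* The equation Delta J (e_j) = 0, solved for the rough Laplacian of J. *)
have rough j : \sum_i h x (e i x) (e i) (e j)
    = \sum_i (- curvature D (e i) (e j) (endo_apply J (e i)) x
              + endo_apply J (curvature D (e i) (e j) (e i)) x).
  have := harm U x (fun=> e j) openU Ux (fun=> es j).
  rewrite /hodge_laplacian.
  rewrite (ext_deriv_codiff lcD openU frame_e smoothJ _ Ux).
  rewrite (codiff_ext lcD openU frame_e smoothJ openU Ux Ux (es j)).
  have solve (a b c : 'I_n -> 'rV[R]_n) :
      - \sum_i a i - \sum_i (b i - c i) = 0 -> \sum_i b i = \sum_i (c i - a i).
    rewrite !sumrB => abc; apply/esym/subr0_eq; rewrite -[RHS]abc.
    by rewrite opprB addrA (addrC (- _)).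
  move=> /solve ->.
  apply: eq_bigr => i _.
  exact: (ricci_identity lcD openU frame_e smoothJ openU (@subset_refl _ U) Ux).
rewrite (laplacian_energy lcD openU frame_e smoothJ Ux).
under eq_bigr do rewrite big_split /=.
rewrite big_split /= addrC -addrA; congr (_ + _).
  apply: eq_bigr => i _; apply: eq_bigr => j _.
  by rewrite (cov_form_endo lcD openU frame_e smoothJ (e i) openU Ux Ux
    (Xs := fun=> e j) (es j)).
rewrite exchange_big [X in - X + _]exchange_big [X in _ + X]exchange_big /=.
rewrite -sumrN -big_split /=; apply: eq_bigr => j _.
rewrite -metric_suml rough metric_suml -sumrN -big_split /=.
by apply: eq_bigr => i _; rewrite (addrC (- curvature _ _ _ _ _)) metricBl addrC.
Qed.
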